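(* Let $\mathcal C$ be a category with finite limits and let $(\mathsf L,\mathsf R)$ be a weak factorization system on $\mathcal C$. The following properties of $(\mathsf L,\mathsf R)$ are equivalent: (1) $(\mathsf L,\mathsf R)$ has an $\mathrm{Id}$-presentation, i.e. there is an $\mathrm{Id}$-presentation $I$ with $[\mathbf F(I)]=(\mathsf L,\mathsf R)$; (2) $(\mathsf L,\mathsf R)$ is type-theoretic; (3) $(\mathsf L,\mathsf R)$ is generated by a Moore relation system, i.e. there is a Moore relation system $R$ on $\mathcal C$ such that $\mathbf F(R)$ is a weak factorization structure and $[\mathbf F(R)]=(\mathsf L,\mathsf R)$; (4) $(\mathcal C,\mathsf R)$ is a display map category modeling $\Sigma$- and $\mathrm{Id}$-types.
   Context: Conventions: $*$ is a terminal object of $\mathcal C$; finite limits are chosen; $(a,b)$ denotes the morphism into a product or pullback with components $a,b$; $A\,{}_{a}\!\times_{b}B$ is the pullback of $a:A\to Z$ and $b:B\to Z$. For a class $\mathsf D$ of morphisms, $\mathrm{LLP}(\mathsf D)$ is the class of morphisms with the left lifting property against all of $\mathsf D$. Relations. A relation on an object $X$ consists of $\eta_X:X\to\Psi X$ and $\epsilon_{0X},\epsilon_{1X}:\Psi X\to X$ with $\epsilon_{iX}\eta_X=1_X$ ($i=0,1$). A relation $R$ on a category consists of a relation $(\Psi X,\eta_X,\epsilon_{0X},\epsilon_{1X})$ on each object $X$ and, for each morphism $f:X\to Y$, a chosen morphism $\Psi f:\Psi X\to\Psi Y$ with $\epsilon_{iY}\Psi f=f\epsilon_{iX}$ and $\Psi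 f\,\eta_X=\eta_Yf$ (preservation of identities and composition is not required). Factorizations. A factorization $F$ on $\mathcal C$ assigns to each $f:X\to Y$ morphisms $\lambda_Ff:X\to\Phi_Ff$, $\rho_Ff:\Phi_Ff\to Y$ with $\rho_Ff\,\lambda_Ff=f$, and to each commutative square $\langle\alpha,\beta\rangle:f\to g$ (so $g\alpha=\beta f$) a chosen $\Phi_F\langle\alpha,\beta\rangle:\Phi_Ff\to\Phi_Fg$ with $\Phi_F\langle\alpha,\beta\rangle\lambda_Ff=\lambda_Fg\,\alpha$ and $\rho_Fg\,\Phi_F\langle\alpha,\beta\rangle=\beta\,\rho_Ff$ (functoriality not required). $\mathrm{coalg}(F)$ is the class of $f:X\to Y$ for which there is $s:Y\to\Phi_Ff$ with $sf=\lambda_Ff$, $\rho_Ff\,s=1_Y$; $\mathrm{alg}(F)$ is the class of $f:X\to Y$ for which there is $s:\Phi_Ff\to X$ with $s\lambda_Ff=1_X$, $fs=\rho_Ff$. $F$ is a weak factorization structure if $\lambda_Ff\in\mathrm{coalg}(F)$ and $\rho_Ff\in\mathrm{alg}(F)$ for all $f$; then $[F]$ denotes the weak factorization system $(\mathrm{coalg}(F),\mathrm{alg}(F))$. For a relation $R$ on $\mathcal C$, $\mathbf F(R)$ is the factorization sending $f:X\to Y$ to $X\xrightarrow{(1_X,\eta_Yf)}X\,{}_{f}\!\times_{\epsilon_0}\Psi Y\xrightarrow{\epsilon_{1}\pi_{\Psi Y}}Y$ and a square $\langle\alpha,\beta\rangle$ to $\alpha\times\Psi\beta$. Type-theoretic.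 An object $X$ is fibrant in $(\mathsf L,\mathsf R)$ if every morphism from $X$ to a terminal object is in $\mathsf R$. $(\mathsf L,\mathsf R)$ is type-theoretic if all objects are fibrant and $\mathsf L$ is stable under pullback along $\mathsf R$. Display map categories. $(\mathcal C,\mathsf D)$ is a display map category if the class $\mathsf D$ contains all isomorphisms and all morphisms with terminal codomain, and is stable under pullback. It models $\Sigma$-types if $\mathsf D$ is closed under composition. If it models $\Sigma$-types, an identity type of $f:X\to Y$ in $\mathsf D$ is a relation on $f$ in $\mathcal C/Y$, with data $r_f:X\to\mathrm{Id}(f)$, $\epsilon_{0},\epsilon_{1}:\mathrm{Id}(f)\to X$ over $Y$, such that $\epsilon_f=(\epsilon_0,\epsilon_1):\mathrm{Id}(f)\to X\times_YX$ is in $\mathsf D$, and for every $\alpha:A\to X$ in $\mathcal C$ and $i=0,1$ the morphism $(1_A,r_f\alpha):A\to A\,{}_{\alpha}\!\times_{\epsilon_i}\mathrm{Id}(f)$ is in $\mathrm{LLP}(\mathsf D)$. An identity type of an object $X$ is one of $X\to *$. $(\mathcal C,\mathsf D)$ models $\mathrm{Id}$-types if for every object $Y$ there is a relation $I_Y$ on $\mathcal C/Y$ such that $I_Y(f)$ is an identity type of $f$ for every $f\in\mathsf D$ with codomain $Y$. A relation $I$ on $\mathcal C$ is a model of $\mathrm{Id}$-types of objects in $(\mathcal C,\mathsf D)$ if $I(X)$ is an identity type of $X$ for every object $X$. $\mathrm{Id}$-presentations. A relation $I$ on $\mathcal C$ is an $\mathrm{Id}$-presentation (of the weak factorization system $[\mathbf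 F(I)]$) if $\mathbf F(I)$ is a weak factorization structure and $I$ is a model of $\mathrm{Id}$-types of objects in $(\mathcal C,\mathrm{alg}(\mathbf F(I)))$ (which is automatically a display map category modeling $\Sigma$-types). Moore relation systems. A relation $R$ on $\mathcal C$ is a Moore relation system if it is transitive, homotopical and symmetric. Transitive: for each $X$ there is $\mu_X:\Psi X\,{}_{\epsilon_1}\!\times_{\epsilon_0}\Psi X\to\Psi X$ with $\epsilon_0\mu_X=\epsilon_0\pi_0$, $\epsilon_1\mu_X=\epsilon_1\pi_1$, $\mu_X(1,\eta\epsilon_1)=1_{\Psi X}$. Homotopical: for each $X$ there are an object $\Psi^{\square}X$ and morphisms $\eta^{\square}:X\to\Psi^{\square}X$, $\epsilon^{\square}_0,\epsilon^{\square}_1,\zeta:\Psi^{\square}X\to\Psi X$, $\delta_X:\Psi X\to\Psi^{\square}X$, and for each $f:X\to Y$ a morphism $\tau_f:X\,{}_{\eta f}\!\times_{\zeta}\Psi^{\square}Y\to\Psi(X\,{}_{f}\!\times_{\epsilon_0}\Psi Y)$, such that $\epsilon^{\square}_i\eta^{\square}=\eta$, $\zeta\eta^{\square}=\eta$, $\epsilon_0\epsilon^{\square}_i=\epsilon_i\zeta$, $\delta\eta=\eta^{\square}$, $\epsilon^{\square}_0\delta=\zeta\delta=\eta\epsilon_0$, $\epsilon^{\square}_1\delta=1_{\Psi X}$, $\tau_f(1_X,\eta^{\square}f)=\eta(1_X,\eta f)$, and $\epsilon_i\tau_f=1_X\times\epsilon^{\square}_i$ ($i=0,1$). Symmetric: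 for each $X$ there is $\nu_X:\Psi X\,{}_{\epsilon_0}\!\times_{\epsilon_0}\Psi X\to\Psi X$ with $\epsilon_0\nu_X=\epsilon_1\pi_0$, $\epsilon_1\nu_X=\epsilon_1\pi_1$, $\nu_X(\eta\epsilon_0,1)=1_{\Psi X}$. *)

(* Defs.v *)
From Stdlib Require Import ProofIrrelevance.

Set Implicit Arguments.
Unset Strict Implicit.
Unset Printing Implicit Defensive.

Declare Scope cat_scope.
Delimit Scope cat_scope with cat.
Local Open Scope cat_scope.

Record category := Category {
  obj :> Type;
  hom : obj -> obj -> Type;
  idm : forall X, hom X X;
  comp : forall X Y Z, hom Y Z -> hom X Y -> hom X Z;
  comp_idl : forall X Y (f : hom X Y), comp (idm Y) f = f;
  comp_idr : forall X Y (f : hom X Y), comp f (idm X) = f;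
  comp_assoc : forall W X Y Z (h : hom Y Z) (g : hom X Y) (f : hom W X),
    comp h (comp g f) = comp (comp h g) f
}.

Arguments hom {_} _ _.
Arguments idm {_} _.
Arguments comp {_ _ _ _} _ _.

Notation "X ~> Y" := (hom X Y) (at level 80, no associativity) : cat_scope.
Notation "g ∘ f" := (comp g f) (at level 40, left associativity) : cat_scope.

Definition mor_class (C : category) := forall X Y : C, (X ~> Y) -> Prop.

Notation "f ∈ D" := (D _ _ f) (at level 70, only parsing) : cat_scope.

Section Notions.
Context {C : category}.

Definition same_class (D E : mor_class C) : Prop :=
  forall (X Y : C) (f : X ~> Y), f ∈ D <-> f ∈ E.

Definition is_iso {X Y : C} (f : X ~> Y) : Prop :=
  exists g : Y ~> X, g ∘ f = idm X /\ f ∘ g = idm Y.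

Definition is_terminal (T : C) : Prop :=
  forall X : C, exists! f : X ~> T, True.

Definition is_pullback {P A B Z : C}
    (p : P ~> A) (q : P ~> B) (a : A ~> Z) (b : B ~> Z) : Prop :=
  a ∘ p = b ∘ q /\
  forall (T : C) (x : T ~> A) (y : T ~> B), a ∘ x = b ∘ y ->
    exists! h : T ~> P, p ∘ h = x /\ q ∘ h = y.

Definition lifts {A B X Y : C} (l : A ~> B) (r : X ~> Y) : Prop :=
  forall (u : A ~> X) (v : B ~> Y), r ∘ u = v ∘ l ->
    exists h : B ~> X, h ∘ l = u /\ r ∘ h = v.

Definition LLP (D : mor_class C) : mor_class C :=
  fun A B l => forall (X Y : C) (r : X ~> Y), r ∈ D -> lifts l r.

Definition RLP (D : mor_class C) : mor_class C :=
  fun X Y r => forall (A B : C) (l : A ~> B), l ∈ D -> lifts l r.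

Definition is_wfs (L R : mor_class C) : Prop :=
  (forall (X Y : C) (f : X ~> Y),
     exists (Z : C) (l : X ~> Z) (r : Z ~> Y), l ∈ L /\ r ∈ R /\ r ∘ l = f) /\
  same_class L (LLP R) /\
  same_class R (RLP L).

Definition pullback_stable (D : mor_class C) : Prop :=
  forall (P A B Z : C) (p : P ~> A) (q : P ~> B) (a : A ~> Z) (b : B ~> Z),
    is_pullback p q a b -> a ∈ D -> q ∈ D.

Definition pullback_stable_along (L R : mor_class C) : Prop :=
  forall (P A B Z : C) (p : P ~> A) (q : P ~> B) (a : A ~> Z) (b : B ~> Z),
    is_pullback p q a b -> a ∈ L -> b ∈ R -> q ∈ L.

Definition fibrant (R : mor_class C) (X : C) : Prop :=
  forall (T : C) (f : X ~> T), is_terminal T -> f ∈ R.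

Definition type_theoretic (L R : mor_class C) : Prop :=
  (forall X : C, fibrant R X) /\ pullback_stable_along L R.

Definition display_map_category (D : mor_class C) : Prop :=
  (forall (X Y : C) (f : X ~> Y), is_iso f -> f ∈ D) /\
  (forall (X T : C) (f : X ~> T), is_terminal T -> f ∈ D) /\
  pullback_stable D.

Definition models_Sigma (D : mor_class C) : Prop :=
  forall (X Y Z : C) (g : Y ~> Z) (f : X ~> Y), g ∈ D -> f ∈ D -> g ∘ f ∈ D.

(* The endpoint maps are indexed by [bool]: [false] is 0 and [true] is 1. *)
Record obj_relation (X : C) := ObjRelation {
  Psi : C;
  eta : X ~> Psi;
  eps : bool -> (Psi ~> X);
  eps_eta : forall i, eps i ∘ eta = idm X
}.

End Notions.

Arguments Psi {C X} _.
Arguments eta {C X} _.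
Arguments eps {C X} _ _.
Notation eps0 r := (eps r false).
Notation eps1 r := (eps r true).

Record cat_relation (C : category) := CatRelation {
  rel_at :> forall X : C, obj_relation X;
  Psi_map : forall X Y : C, (X ~> Y) -> (Psi (rel_at X) ~> Psi (rel_at Y));
  Psi_map_eps : forall (X Y : C) (f : X ~> Y) (i : bool),
    eps (rel_at Y) i ∘ Psi_map f = f ∘ eps (rel_at X) i;
  Psi_map_eta : forall (X Y : C) (f : X ~> Y),
    Psi_map f ∘ eta (rel_at X) = eta (rel_at Y) ∘ f
}.

Record factorization (C : category) := Factorization {
  Phi : forall X Y : C, (X ~> Y) -> C;
  lam : forall (X Y : C) (f : X ~> Y), X ~> Phi f;
  rho : forall (X Y : C) (f : X ~> Y), Phi f ~> Y;
  rho_lam : forall (X Y : C) (f : X ~> Y), rho f ∘ lam f = f;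
  Phi_map : forall (X Y X' Y' : C) (f : X ~> Y) (g : X' ~> Y')
    (a : X ~> X') (b : Y ~> Y'), g ∘ a = b ∘ f -> (Phi f ~> Phi g);
  Phi_map_lam : forall (X Y X' Y' : C) (f : X ~> Y) (g : X' ~> Y')
    (a : X ~> X') (b : Y ~> Y') (e : g ∘ a = b ∘ f),
    Phi_map e ∘ lam f = lam g ∘ a;
  rho_Phi_map : forall (X Y X' Y' : C) (f : X ~> Y) (g : X' ~> Y')
    (a : X ~> X') (b : Y ~> Y') (e : g ∘ a = b ∘ f),
    rho g ∘ Phi_map e = b ∘ rho f
}.

Arguments Phi {C} _ {X Y} _.
Arguments lam {C} _ {X Y} _.
Arguments rho {C} _ {X Y} _.
Arguments Phi_map {C} _ {X Y X' Y' f g a b} _.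

Section Factorizations.
Context {C : category} (F : factorization C).

Definition coalg : mor_class C := fun X Y f =>
  exists s : Y ~> Phi F f, s ∘ f = lam F f /\ rho F f ∘ s = idm Y.

Definition alg : mor_class C := fun X Y f =>
  exists s : Phi F f ~> X, s ∘ lam F f = idm X /\ f ∘ s = rho F f.

Definition is_weak_factorization_structure : Prop :=
  forall (X Y : C) (f : X ~> Y), lam F f ∈ coalg /\ rho F f ∈ alg.

(* [F] = (L, R) *)
Definition generates (L R : mor_class C) : Prop :=
  same_class coalg L /\ same_class alg R.

End Factorizations.

Section Slice.
Context (C : category) (Y : C).

Record slice_obj := SliceObj { dom : C; arr : dom ~> Y }.

Record slice_hom (f g : slice_obj) := SliceHom {
  mor : dom f ~> dom g;
  mor_comm : arr g ∘ mor = arr f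
}.

Lemma slice_hom_eq (f g : slice_obj) (u v : slice_hom f g) :
  mor u = mor v -> u = v.
Proof.
destruct u as [u eu], v as [v ev]; simpl; intros e; subst v.
f_equal; apply proof_irrelevance.
Qed.

Lemma slice_comp_comm (f g h : slice_obj) (v : slice_hom g h) (u : slice_hom f g) :
  arr h ∘ (mor v ∘ mor u) = arr f.
Proof. now rewrite comp_assoc, !mor_comm. Qed.

Definition slice_id (f : slice_obj) : slice_hom f f :=
  @SliceHom f f (idm (dom f)) (comp_idr (arr f)).

Definition slice_comp (f g h : slice_obj)
    (v : slice_hom g h) (u : slice_hom f g) : slice_hom f h :=
  SliceHom (slice_comp_comm v u).

Lemma slice_idl (f g : slice_obj) (u : slice_hom f g) :
  slice_comp (slice_id g) u = u.
Proof. apply slice_hom_eq, comp_idl. Qed.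

Lemma slice_idr (f g : slice_obj) (u : slice_hom f g) :
  slice_comp u (slice_id f) = u.
Proof. apply slice_hom_eq, comp_idr. Qed.

Lemma slice_assoc (e f g h : slice_obj)
    (w : slice_hom g h) (v : slice_hom f g) (u : slice_hom e f) :
  slice_comp w (slice_comp v u) = slice_comp (slice_comp w v) u.
Proof. apply slice_hom_eq, comp_assoc. Qed.

Definition slice : category := Category slice_idl slice_idr slice_assoc.

End Slice.

Arguments slice C Y : clear implicits.
Arguments SliceObj {C Y dom} _.
Arguments dom {C Y} _.
Arguments arr {C Y} _.
Arguments mor {C Y f g} _.

(* A category with chosen finite limits, presented by a chosen terminal object
   and chosen pullbacks; every construction below uses only these. *)
Record lex_category := LexCategory {
  lex_cat :> category;
  one : lex_cat;
  bang : forall X : lex_cat, X ~> one;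
  bang_unique : forall (X : lex_cat) (f g : X ~> one), f = g;
  pb : forall A B Z : lex_cat, (A ~> Z) -> (B ~> Z) -> lex_cat;
  pr0 : forall (A B Z : lex_cat) (a : A ~> Z) (b : B ~> Z), pb a b ~> A;
  pr1 : forall (A B Z : lex_cat) (a : A ~> Z) (b : B ~> Z), pb a b ~> B;
  pb_square : forall (A B Z : lex_cat) (a : A ~> Z) (b : B ~> Z),
    a ∘ pr0 a b = b ∘ pr1 a b;
  pbpair : forall (A B Z : lex_cat) (a : A ~> Z) (b : B ~> Z) (T : lex_cat)
    (x : T ~> A) (y : T ~> B), a ∘ x = b ∘ y -> (T ~> pb a b);
  pr0_pbpair : forall (A B Z : lex_cat) (a : A ~> Z) (b : B ~> Z) (T : lex_cat)
    (x : T ~> A) (y : T ~> B) (e : a ∘ x = b ∘ y), pr0 a b ∘ pbpair e = x;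
  pr1_pbpair : forall (A B Z : lex_cat) (a : A ~> Z) (b : B ~> Z) (T : lex_cat)
    (x : T ~> A) (y : T ~> B) (e : a ∘ x = b ∘ y), pr1 a b ∘ pbpair e = y;
  pb_ext : forall (A B Z : lex_cat) (a : A ~> Z) (b : B ~> Z) (T : lex_cat)
    (h k : T ~> pb a b),
    pr0 a b ∘ h = pr0 a b ∘ k -> pr1 a b ∘ h = pr1 a b ∘ k -> h = k
}.

Arguments one {_}.
Arguments bang {_} _.
Arguments pb {_ A B Z} _ _.
Arguments pr0 {_ A B Z} _ _.
Arguments pr1 {_ A B Z} _ _.
Arguments pbpair {_ A B Z a b T} _ _ _.

Section Lex.
Context {C : lex_category}.

Lemma one_terminal : is_terminal (@one C).
Proof.
intros X; exists (bang X); split; [exact I | intros; apply bang_unique].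
Qed.

Lemma pb_is_pullback (A B Z : C) (a : A ~> Z) (b : B ~> Z) :
  is_pullback (pr0 a b) (pr1 a b) a b.
Proof.
split; [apply pb_square | intros T x y e].
exists (pbpair x y e); split.
- split; [apply pr0_pbpair | apply pr1_pbpair].
- intros h [h0 h1]; apply pb_ext.
  + now rewrite pr0_pbpair.
  + now rewrite pr1_pbpair.
Qed.

Section FactorizationOfRelation.
Context (R : cat_relation C).

Lemma Flam_comm (X Y : C) (f : X ~> Y) :
  f ∘ idm X = eps0 (R Y) ∘ (eta (R Y) ∘ f).
Proof. now rewrite comp_assoc, eps_eta, comp_idl, comp_idr. Qed.

Definition Flam (X Y : C) (f : X ~> Y) : X ~> pb f (eps0 (R Y)) :=
  pbpair (idm X) (eta (R Y) ∘ f) (Flam_comm f).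

Definition Frho (X Y : C) (f : X ~> Y) : pb f (eps0 (R Y)) ~> Y :=
  eps1 (R Y) ∘ pr1 f (eps0 (R Y)).

Lemma Frho_lam (X Y : C) (f : X ~> Y) : Frho f ∘ Flam f = f.
Proof.
unfold Frho, Flam.
now rewrite <- comp_assoc, pr1_pbpair, comp_assoc, eps_eta, comp_idl.
Qed.

Lemma Fmap_comm (X Y X' Y' : C) (f : X ~> Y) (g : X' ~> Y')
    (a : X ~> X') (b : Y ~> Y') (e : g ∘ a = b ∘ f) :
  g ∘ (a ∘ pr0 f (eps0 (R Y))) =
  eps0 (R Y') ∘ (Psi_map R b ∘ pr1 f (eps0 (R Y))).
Proof.
now rewrite !comp_assoc, e, Psi_map_eps, <- !comp_assoc, pb_square.
Qed.

Definition Fmap (X Y X' Y' : C) (f : X ~> Y) (g : X' ~> Y')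
    (a : X ~> X') (b : Y ~> Y') (e : g ∘ a = b ∘ f) :
    pb f (eps0 (R Y)) ~> pb g (eps0 (R Y')) :=
  pbpair (a ∘ pr0 f (eps0 (R Y))) (Psi_map R b ∘ pr1 f (eps0 (R Y)))
         (Fmap_comm e).

Lemma Fmap_lam (X Y X' Y' : C) (f : X ~> Y) (g : X' ~> Y')
    (a : X ~> X') (b : Y ~> Y') (e : g ∘ a = b ∘ f) :
  Fmap e ∘ Flam f = Flam g ∘ a.
Proof.
unfold Fmap, Flam; apply pb_ext; rewrite !comp_assoc.
- now rewrite !pr0_pbpair, <- comp_assoc, pr0_pbpair, comp_idr, comp_idl.
- now rewrite !pr1_pbpair, <- comp_assoc, pr1_pbpair, comp_assoc, Psi_map_eta,
    <- !comp_assoc, e.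
Qed.

Lemma Frho_map (X Y X' Y' : C) (f : X ~> Y) (g : X' ~> Y')
    (a : X ~> X') (b : Y ~> Y') (e : g ∘ a = b ∘ f) :
  Frho g ∘ Fmap e = b ∘ Frho f.
Proof.
unfold Frho, Fmap.
now rewrite <- comp_assoc, pr1_pbpair, !comp_assoc, Psi_map_eps.
Qed.

Definition FF : factorization C := Factorization Frho_lam Fmap_lam Frho_map.

End FactorizationOfRelation.

Section IdentityTypes.
Context (D : mor_class C).

Lemma Id_eps_comm (X Y : C) (f : X ~> Y)
    (r : @obj_relation (slice C Y) (SliceObj f)) :
  f ∘ mor (eps0 r) = f ∘ mor (eps1 r).
Proof.
exact (eq_trans (mor_comm (eps0 r)) (eq_sym (mor_comm (eps1 r)))).
Qed.

Lemma Id_eta_comm (X Y : C) (f : X ~> Y)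
    (r : @obj_relation (slice C Y) (SliceObj f))
    (A : C) (alpha : A ~> X) (i : bool) :
  alpha ∘ idm A = mor (eps r i) ∘ (mor (eta r) ∘ alpha).
Proof.
rewrite comp_idr, comp_assoc.
change (mor (eps r i) ∘ mor (eta r)) with (mor (eps r i ∘ eta r)).
rewrite eps_eta; simpl; now rewrite comp_idl.
Qed.

(* Meant for [f] in [D]; that hypothesis is imposed where the notion is used. *)
Definition is_identity_type (X Y : C) (f : X ~> Y)
    (r : @obj_relation (slice C Y) (SliceObj f)) : Prop :=
  pbpair (mor (eps0 r)) (mor (eps1 r)) (Id_eps_comm r) ∈ D /\
  forall (A : C) (alpha : A ~> X) (i : bool),
    pbpair (idm A) (mor (eta r) ∘ alpha) (Id_eta_comm r alpha i) ∈ LLP D.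

Definition models_Id : Prop :=
  forall Y : C, exists I : cat_relation (slice C Y),
    forall (X : C) (f : X ~> Y), f ∈ D -> is_identity_type (I (SliceObj f)).

(* A relation on X, seen as a relation on X -> * in C/*. *)
Definition to_one {X Z : C} (u : X ~> Z) :
    @hom (slice C one) (SliceObj (bang X)) (SliceObj (bang Z)) :=
  @SliceHom C one (SliceObj (bang X)) (SliceObj (bang Z)) u (bang_unique _ _).

Lemma to_one_eps_eta (X : C) (r : obj_relation X) (i : bool) :
  to_one (eps r i) ∘ to_one (eta r) =
  @idm (slice C one) (SliceObj (bang X)).
Proof. apply slice_hom_eq; apply eps_eta. Qed.

Definition obj_relation_to_one (X : C) (r : obj_relation X) :
    @obj_relation (slice C one) (SliceObj (bang X)) :=
  ObjRelation (to_one_eps_eta r).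

Definition models_Id_of_objects (I : cat_relation C) : Prop :=
  forall X : C, is_identity_type (obj_relation_to_one (I X)).

End IdentityTypes.

Definition Id_presentation (I : cat_relation C) : Prop :=
  is_weak_factorization_structure (FF I) /\
  models_Id_of_objects (alg (FF I)) I.

Section Moore.
Context (R : cat_relation C).

Lemma mu_unit_comm (X : C) :
  eps1 (R X) ∘ idm (Psi (R X)) = eps0 (R X) ∘ (eta (R X) ∘ eps1 (R X)).
Proof. now rewrite comp_assoc, eps_eta, comp_idl, comp_idr. Qed.

Definition transitive_relation : Prop :=
  forall X : C, exists mu : pb (eps1 (R X)) (eps0 (R X)) ~> Psi (R X),
    eps0 (R X) ∘ mu = eps0 (R X) ∘ pr0 _ _ /\
    eps1 (R X) ∘ mu = eps1 (R X) ∘ pr1 _ _ /\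
    mu ∘ pbpair (idm _) (eta (R X) ∘ eps1 (R X)) (mu_unit_comm X) = idm _.

Lemma nu_unit_comm (X : C) :
  eps0 (R X) ∘ (eta (R X) ∘ eps0 (R X)) = eps0 (R X) ∘ idm (Psi (R X)).
Proof. now rewrite comp_assoc, eps_eta, comp_idl, comp_idr. Qed.

Definition symmetric_relation : Prop :=
  forall X : C, exists nu : pb (eps0 (R X)) (eps0 (R X)) ~> Psi (R X),
    eps0 (R X) ∘ nu = eps1 (R X) ∘ pr0 _ _ /\
    eps1 (R X) ∘ nu = eps1 (R X) ∘ pr1 _ _ /\
    nu ∘ pbpair (eta (R X) ∘ eps0 (R X)) (idm _) (nu_unit_comm X) = idm _.

Record square_structure (X : C) := SquareStructure {
  PsiS : C;
  etaS : X ~> PsiS;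
  epsS : bool -> (PsiS ~> Psi (R X));
  zetaS : PsiS ~> Psi (R X);
  deltaS : Psi (R X) ~> PsiS;
  epsS_eta : forall i, epsS i ∘ etaS = eta (R X);
  zetaS_eta : zetaS ∘ etaS = eta (R X);
  eps0_epsS : forall i, eps0 (R X) ∘ epsS i = eps (R X) i ∘ zetaS;
  deltaS_eta : deltaS ∘ eta (R X) = etaS;
  epsS0_delta : epsS false ∘ deltaS = eta (R X) ∘ eps0 (R X);
  zetaS_delta : zetaS ∘ deltaS = eta (R X) ∘ eps0 (R X);
  epsS1_delta : epsS true ∘ deltaS = idm (Psi (R X))
}.

Lemma tau_unit_comm (X Y : C) (S : square_structure Y) (f : X ~> Y) :
  (eta (R Y) ∘ f) ∘ idm X = zetaS S ∘ (etaS S ∘ f).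
Proof. now rewrite comp_assoc, zetaS_eta, comp_idr. Qed.

Lemma tau_eps_comm (X Y : C) (S : square_structure Y) (f : X ~> Y) (i : bool) :
  f ∘ pr0 (eta (R Y) ∘ f) (zetaS S) =
  eps0 (R Y) ∘ (epsS S i ∘ pr1 (eta (R Y) ∘ f) (zetaS S)).
Proof.
rewrite comp_assoc, eps0_epsS, <- comp_assoc, <- pb_square, !comp_assoc.
now rewrite eps_eta, comp_idl.
Qed.

Definition homotopical_relation : Prop :=
  exists S : forall X : C, square_structure X,
  forall (X Y : C) (f : X ~> Y),
  exists tau : pb (eta (R Y) ∘ f) (zetaS (S Y)) ~> Psi (R (pb f (eps0 (R Y)))),
    tau ∘ pbpair (idm X) (etaS (S Y) ∘ f) (tau_unit_comm (S Y) f) =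
      eta (R (pb f (eps0 (R Y)))) ∘
        pbpair (idm X) (eta (R Y) ∘ f) (Flam_comm R f) /\
    forall i : bool,
      eps (R (pb f (eps0 (R Y)))) i ∘ tau =
        pbpair (pr0 _ _) (epsS (S Y) i ∘ pr1 _ _) (tau_eps_comm (S Y) f i).

Definition Moore_relation_system : Prop :=
  transitive_relation /\ homotopical_relation /\ symmetric_relation.

End Moore.
End Lex.

(* Main.v *)
(** Conditions (1), (3) and (4) each provide path objects for which L consists of
    the strong deformation retracts.  For [p : E ~> B] in R they also provide a
    transport [t] of points of [E] backwards along paths of [B], and a path in [E]
    from [t (e, c)] to [e], constant when [c] is; with identity types both are
    lifts against R, with a Moore relation system they come from
    [tau], [delta] and [nu].  Transporting along the deformation of [B] onto [A]
    then deforms [E] onto the pullback of [A], so L is stable under pullback along R.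

    Conversely, in a type-theoretic system the (L, R)-factorizations of diagonals are
    identity types, and the Moore structure is obtained by lifting unit maps such as
    [(1, eta f)], which are in L, against the R-maps of these factorizations. *)
From Stdlib Require Import IndefiniteDescription ProofIrrelevance.
Require Import Defs.

Local Open Scope cat_scope.
Set Implicit Arguments.
Unset Strict Implicit.
Unset Printing Implicit Defensive.

(** * Choice and rewriting tools for chosen pullbacks *)

Lemma dependent_functional_choice (A : Type) (B : A -> Type)
    (P : forall a, B a -> Prop) :
  (forall a, exists b, P a b) -> exists f : forall a, B a, forall a, P a (f a).
Proof.
intros h.
exists (fun a => proj1_sig (constructive_indefinite_description _ (h a))).
intros a; exact (proj2_sig (constructive_indefinite_description _ (h a))).
Qed.

Lemma whisker (C : category) (W X Y Z : C) (g : Y ~> Z) (f : X ~> Y) (h : X ~> Z) :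
  g ∘ f = h -> forall k : W ~> X, g ∘ (f ∘ k) = h ∘ k.
Proof. intros <- k; apply comp_assoc. Qed.

Section ChosenPullbacks.
Context (C : lex_category).
Context (A B Z : C) (a : A ~> Z) (b : B ~> Z) (T : C).

Lemma pr0_pbpair_whisker (x : T ~> A) (y : T ~> B) (e : a ∘ x = b ∘ y) (S : C) (k : S ~> T) :
  pr0 a b ∘ (pbpair x y e ∘ k) = x ∘ k.
Proof. apply whisker, pr0_pbpair. Qed.

Lemma pr1_pbpair_whisker (x : T ~> A) (y : T ~> B) (e : a ∘ x = b ∘ y) (S : C) (k : S ~> T) :
  pr1 a b ∘ (pbpair x y e ∘ k) = y ∘ k.
Proof. apply whisker, pr1_pbpair. Qed.

Lemma pbpair_irrelevance (x : T ~> A) (y : T ~> B) (e e' : a ∘ x = b ∘ y) :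
  pbpair x y e = pbpair x y e'.
Proof. f_equal; apply proof_irrelevance. Qed.

End ChosenPullbacks.

Lemma eps_eta_whisker (C : category) (X : C) (P : obj_relation X) (i : bool)
    (W : C) (k : W ~> X) : eps P i ∘ (eta P ∘ k) = k.
Proof. rewrite (whisker (eps_eta P i)); apply comp_idl. Qed.

#[local] Hint Rewrite <- comp_assoc : cat.
#[local] Hint Rewrite pr0_pbpair pr1_pbpair pr0_pbpair_whisker pr1_pbpair_whisker
  @eps_eta @eps_eta_whisker comp_idl comp_idr : cat.

Ltac cat := autorewrite with cat.

Lemma is_pullback_flip (C : category) (P A B Z : C)
    (p : P ~> A) (q : P ~> B) (a : A ~> Z) (b : B ~> Z) :
  is_pullback p q a b -> is_pullback q p b a.
Proof.
intros [e u]; split; [now symmetry | intros T x y exy].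
destruct (u T y x (eq_sym exy)) as [h [[h1 h2] hu]].
exists h; split; [now split | intros k [k1 k2]; apply hu; now split].
Qed.

(** * Closure properties of weak factorization systems *)

Section WeakFactorizationSystem.
Context (C : lex_category) (L R : mor_class C) (HLR : is_wfs L R).

Lemma wfs_lifts (A B X Y : C) (l : A ~> B) (r : X ~> Y) :
  l ∈ L -> r ∈ R -> lifts l r.
Proof. intros hl; apply (proj1 (proj2 HLR)); exact hl. Qed.

Lemma L_of_lifts (A B : C) (l : A ~> B) : l ∈ LLP R -> l ∈ L.
Proof. apply (proj1 (proj2 HLR)). Qed.

Lemma LLP_of_L (A B : C) (l : A ~> B) : l ∈ L -> l ∈ LLP R.
Proof. apply (proj1 (proj2 HLR)). Qed.

Lemma R_of_lifts (X Y : C) (r : X ~> Y) : r ∈ RLP L -> r ∈ R.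
Proof. apply (proj2 (proj2 HLR)). Qed.

Lemma wfs_factor (X Y : C) (f : X ~> Y) :
  exists (Z : C) (l : X ~> Z) (r : Z ~> Y), l ∈ L /\ r ∈ R /\ r ∘ l = f.
Proof. apply (proj1 HLR). Qed.

Lemma R_iso (X Y : C) (f : X ~> Y) : is_iso f -> f ∈ R.
Proof.
intros [g [gf fg]]; apply R_of_lifts; intros A B l _ u v e.
exists (g ∘ v); split.
- now rewrite <- comp_assoc, <- e, (whisker gf), comp_idl.
- now rewrite (whisker fg), comp_idl.
Qed.

Lemma R_comp : models_Sigma R.
Proof.
intros X Y Z g f hg hf; apply R_of_lifts; intros A B l hl u v e.
destruct (wfs_lifts hl hg (u := f ∘ u) (v := v)) as [h [h1 h2]].
{ now rewrite comp_assoc. }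
destruct (wfs_lifts hl hf (u := u) (v := h)) as [k [k1 k2]]; [now symmetry |].
exists k; split; [exact k1 | now rewrite <- comp_assoc, k2].
Qed.

Lemma R_pullback : pullback_stable R.
Proof.
intros P A B Z p q a b [e un] ha; apply R_of_lifts; intros S T l hl u v euv.
destruct (wfs_lifts hl ha (u := p ∘ u) (v := b ∘ v)) as [h [h1 h2]].
{ now rewrite comp_assoc, e, <- !comp_assoc, euv. }
destruct (un T h v h2) as [k [[k1 k2] _]].
exists k; split; [| exact k2].
destruct (un S (p ∘ u) (q ∘ u)) as [m [_ mu]]; [now rewrite !comp_assoc, e |].
transitivity m; [symmetry |]; apply mu; split; trivial.
- now rewrite (whisker k1).
- now rewrite (whisker k2).
Qed.

Lemma R_pr1 (A B Z : C) (a : A ~> Z) (b : B ~> Z) : a ∈ R -> pr1 a b ∈ R.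
Proof. exact (R_pullback (pb_is_pullback a b)). Qed.

Lemma R_pr0 (A B Z : C) (a : A ~> Z) (b : B ~> Z) : b ∈ R -> pr0 a b ∈ R.
Proof. exact (R_pullback (is_pullback_flip (pb_is_pullback a b))). Qed.

Lemma L_comp (X Y Z : C) (g : Y ~> Z) (f : X ~> Y) : g ∈ L -> f ∈ L -> g ∘ f ∈ L.
Proof.
intros hg hf; apply L_of_lifts; intros A B r hr u v e.
destruct (wfs_lifts hf hr (u := u) (v := v ∘ g)) as [h [h1 h2]].
{ now rewrite <- comp_assoc. }
destruct (wfs_lifts hg hr (u := h) (v := v)) as [k [k1 k2]]; [exact h2 |].
exists k; split; [now rewrite (whisker k1) | exact k2].
Qed.

(** With the identity on [X], the maps [g] and [q] make [f] a retract of [g ∘ f]. *)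
Lemma L_cancel (X Y Z : C) (g : Y ~> Z) (f : X ~> Y) (q : Z ~> Y) :
  q ∘ g = idm Y -> g ∘ f ∈ L -> f ∈ L.
Proof.
intros qg hgf; apply L_of_lifts; intros A B r hr u v e.
destruct (wfs_lifts hgf hr (u := u) (v := v ∘ q)) as [h [h1 h2]].
{ now rewrite <- comp_assoc, (whisker qg), comp_idl. }
exists (h ∘ g); split; [now rewrite <- comp_assoc |].
now rewrite (whisker h2), <- comp_assoc, qg, comp_idr.
Qed.

(** The retract argument: a coalgebra structure makes [f] a retract of [lam F f], an algebra
    structure makes it a retract of [rho F f], and conversely both structures are lifts. *)
Lemma generates_of_factorization (F : factorization C) :
  (forall (X Y : C) (f : X ~> Y), lam F f ∈ L) ->
  (forall (X Y : C) (f : X ~> Y), rho F f ∈ R) ->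
  is_weak_factorization_structure F /\ generates F L R.
Proof.
intros hlam hrho.
assert (gL : same_class (coalg F) L).
{ intros X Y f; split.
  - intros [s [s1 s2]]; apply L_cancel with (1 := s2); rewrite s1; apply hlam.
  - intros hf; apply (wfs_lifts hf (hrho _ _ f)).
    now rewrite rho_lam, comp_idl. }
assert (gR : same_class (alg F) R).
{ intros X Y f; split.
  - intros [s [s1 s2]]; apply R_of_lifts; intros A B l hl u v e.
    destruct (wfs_lifts hl (hrho _ _ f) (u := lam F f ∘ u) (v := v)) as [h [h1 h2]].
    { now rewrite (whisker (rho_lam F f)). }
    exists (s ∘ h); split.
    + now rewrite <- comp_assoc, h1, (whisker s1), comp_idl.
    + now rewrite (whisker s2).
  - intros hf; apply (wfs_lifts (hlam _ _ f) hf).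
    now rewrite rho_lam, comp_idr. }
split; [| now split].
intros X Y f; split; [apply gL, hlam | apply gR, hrho].
Qed.

End WeakFactorizationSystem.

(** * Strong deformation retracts and path transport *)

Section Deformation.
Context (C : lex_category) (L R : mor_class C).
Context (P : forall X : C, obj_relation X).

Definition deformation_retract (A B : C) (l : A ~> B) : Prop :=
  exists (r : B ~> A) (H : B ~> Psi (P B)),
    r ∘ l = idm A /\ eps0 (P B) ∘ H = l ∘ r /\ eps1 (P B) ∘ H = idm B /\
    H ∘ l = eta (P B) ∘ l.

(** The last clause says that [k] is constant over constant paths. As [t] is the source of [k], it
    also makes [t] fix points along constant paths. *)
Definition path_transport (E B : C) (p : E ~> B) : Prop :=
  exists (t : pb p (eps1 (P B)) ~> E) (k : pb p (eps1 (P B)) ~> Psi (P E)),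
    p ∘ t = eps0 (P B) ∘ pr1 _ _ /\
    eps0 (P E) ∘ k = t /\ eps1 (P E) ∘ k = pr0 _ _ /\
    forall (T : C) (x : T ~> E) (e : p ∘ x = eps1 (P B) ∘ (eta (P B) ∘ (p ∘ x))),
      k ∘ pbpair x (eta (P B) ∘ (p ∘ x)) e = eta (P E) ∘ x.

Lemma L_stable_of_path_transport :
  (forall (A B : C) (l : A ~> B), l ∈ L <-> deformation_retract l) ->
  (forall (E B : C) (p : E ~> B), p ∈ R -> path_transport p) ->
  pullback_stable_along L R.
Proof.
intros hL hR A' A E B pA l' l p [sq un] hl hp; apply hL.
apply hL in hl; destruct hl as [r [H [rl [H0 [H1 Hl]]]]].
destruct (hR _ _ _ hp) as [t [k [pt [k0 [k1 kc]]]]].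
assert (e : p ∘ idm E = eps1 (P B) ∘ (H ∘ p)).
{ now rewrite (whisker H1), comp_idl, comp_idr. }
(* A point of [E] is paired with the deformation path that ends at its image in [B]; on [A'] this
   path is constant, so [k ∘ c] is constant there. *)
set (c := pbpair (idm E) (H ∘ p) e).
assert (kl : k ∘ (c ∘ l') = eta (P E) ∘ l').
{ assert (e' : p ∘ l' = eps1 (P B) ∘ (eta (P B) ∘ (p ∘ l'))) by now cat.
  rewrite <- (kc _ _ e'); f_equal; unfold c; apply pb_ext; cat; trivial.
  now rewrite <- sq, (whisker Hl), comp_assoc. }
assert (tl : t ∘ (c ∘ l') = l') by now rewrite <- k0, <- comp_assoc, kl; cat.
(* Transport along the deformation ends over the image of [l], hence factors through the pullback:
   this is the retraction, and [k ∘ c] is its homotopy. *)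
destruct (un E (r ∘ p) (t ∘ c)) as [r' [[r'0 r'1] _]].
{ rewrite (whisker pt); unfold c; cat; now rewrite (whisker H0), comp_assoc. }
exists r', (k ∘ c); repeat split.
- destruct (un A' pA l' sq) as [m [_ mu]].
  transitivity m; [symmetry |]; apply mu; split; cat; trivial.
  + now rewrite (whisker r'0), <- comp_assoc, <- sq, (whisker rl), comp_idl.
  + now rewrite (whisker r'1), <- comp_assoc.
- now rewrite (whisker k0), r'1.
- rewrite (whisker k1); unfold c; now cat.
- now rewrite <- comp_assoc, kl.
Qed.

End Deformation.

(** The two components of a coalgebra structure into the pullback are the retraction and the
    homotopy. *)
Lemma coalg_FF (C : lex_category) (I : cat_relation C) (A B : C) (l : A ~> B) :
  l ∈ coalg (FF I) <-> deformation_retract I l.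
Proof.
split.
- intros [s [s1 s2]]; simpl in s1, s2; unfold Flam, Frho in *.
  exists (pr0 _ _ ∘ s), (pr1 _ _ ∘ s); repeat split.
  + rewrite <- comp_assoc, s1; now cat.
  + now rewrite !comp_assoc, pb_square.
  + now rewrite comp_assoc.
  + rewrite <- comp_assoc, s1; now cat.
- intros [r [H [rl [H0 [H1 Hl]]]]].
  exists (pbpair r H (eq_sym H0)); simpl; unfold Flam, Frho; split.
  + apply pb_ext; now cat.
  + now cat.
Qed.

(** * Path transport from a Moore relation system *)

Section Moore.
Context (C : lex_category) (M : cat_relation C).

(** Apply [nu] to the pair of a path and the constant path at its source. *)
Lemma reversal (X : C) : symmetric_relation M ->
  exists v : Psi (M X) ~> Psi (M X),
    eps0 (M X) ∘ v = eps1 (M X) /\ eps1 (M X) ∘ v = eps0 (M X) /\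
    v ∘ eta (M X) = eta (M X).
Proof.
intros sym; destruct (sym X) as [n [n0 [n1 nu]]].
assert (e : eps0 (M X) ∘ idm _ = eps0 (M X) ∘ (eta (M X) ∘ eps0 (M X))) by now cat.
exists (n ∘ pbpair _ _ e); repeat split.
- rewrite (whisker n0); now cat.
- rewrite (whisker n1); now cat.
- transitivity (n ∘ pbpair _ _ (nu_unit_comm M X) ∘ eta (M X));
    [| now rewrite nu, comp_idl].
  cat; f_equal; apply pb_ext; now cat.
Qed.

(** For a path [c] starting at [p x], [deltaS] gives a square from the constant path to [c] whose
    [zetaS] side is constant. Through [tau] it becomes a path from [(x, eta (p x))] to [(x, c)],
    whose image under [s] runs from [x] to [s (x, c)]. *)
Lemma alg_path_lifting (E B : C) (p : E ~> B) (s : pb p (eps0 (M B)) ~> E) :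
  homotopical_relation M -> s ∘ Flam M p = idm E ->
  exists k : pb p (eps0 (M B)) ~> Psi (M E),
    eps0 (M E) ∘ k = pr0 _ _ /\ eps1 (M E) ∘ k = s /\
    k ∘ Flam M p = eta (M E).
Proof.
intros [S htau] hs; destruct (htau _ _ p) as [tau [tau1 tau2]].
assert (e : (eta (M B) ∘ p) ∘ pr0 p (eps0 (M B)) =
            zetaS (S B) ∘ (deltaS (S B) ∘ pr1 p (eps0 (M B)))).
{ now rewrite (whisker (zetaS_delta (S B))), <- !comp_assoc, pb_square. }
exists (Psi_map M s ∘ (tau ∘ pbpair _ _ e)); repeat split.
- rewrite (whisker (Psi_map_eps M s _)), <- comp_assoc, (whisker (tau2 _)).
  transitivity (s ∘ (Flam M p ∘ pr0 p (eps0 (M B))));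
    [| now rewrite (whisker hs), comp_idl].
  f_equal; unfold Flam; apply pb_ext; cat; trivial.
  now rewrite (whisker (epsS0_delta (S B))), <- comp_assoc, pb_square.
- rewrite (whisker (Psi_map_eps M s _)), <- comp_assoc, (whisker (tau2 _)).
  transitivity (s ∘ idm _); [| apply comp_idr].
  f_equal; apply pb_ext; cat; trivial.
  now rewrite (whisker (epsS1_delta (S B))), comp_idl.
- transitivity (Psi_map M s ∘ (tau ∘ pbpair _ _ (tau_unit_comm (S B) p))).
  + cat; do 2 f_equal; unfold Flam; apply pb_ext; cat; trivial.
    now rewrite (whisker (deltaS_eta (S B))).
  + rewrite tau1, (whisker (Psi_map_eta M s)), <- comp_assoc.
    fold (Flam M p); now rewrite hs, comp_idr.
Qed.

(** An algebra structure transports forwards, so paths are reversed in [B] before it is applied, and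
    the lifted path is reversed in [E] afterwards. *)
Lemma alg_path_transport (E B : C) (p : E ~> B) :
  homotopical_relation M -> symmetric_relation M ->
  p ∈ alg (FF M) -> path_transport M p.
Proof.
intros hom sym [s [s1 s2]]; simpl in s, s1, s2; unfold Frho in s2.
destruct (alg_path_lifting hom s1) as [k [k0 [k1 kc]]].
destruct (reversal B sym) as [v [v0 [v1 vc]]].
destruct (reversal E sym) as [w [w0 [w1 wc]]].
assert (e : p ∘ pr0 p (eps1 (M B)) = eps0 (M B) ∘ (v ∘ pr1 p (eps1 (M B)))).
{ now rewrite (whisker v0), pb_square. }
exists (s ∘ pbpair _ _ e), (w ∘ (k ∘ pbpair _ _ e)); repeat split.
- rewrite (whisker s2); cat; now rewrite (whisker v1).
- now rewrite (whisker w0), (whisker k1).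
- rewrite (whisker w1), (whisker k0); now cat.
- intros T x e'.
  rewrite <- wc, <- kc, <- !comp_assoc; do 2 f_equal; unfold Flam.
  apply pb_ext; cat; trivial; now rewrite (whisker vc).
Qed.

End Moore.

(** The first projection is an algebra structure, since all parallel maps into a terminal object
    agree. *)
Lemma fibrant_FF (C : lex_category) (I : cat_relation C) (X : C) :
  fibrant (alg (FF I)) X.
Proof.
intros T f hT; exists (pr0 _ _); simpl; unfold Flam; split; [now cat |].
destruct (hT (pb f (eps0 (I T)))) as [m [_ mu]].
transitivity m; [symmetry |]; now apply mu.
Qed.

(** * Identity types of objects in a system with all objects fibrant *)

Section IdentityTypes.
Context (C : lex_category) (L R : mor_class C) (HLR : is_wfs L R).
Context (fib : forall X : C, fibrant R X).

Lemma R_bang (X : C) : bang X ∈ R.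
Proof. apply fib, one_terminal. Qed.

Lemma L_split_mono (X Y : C) (f : X ~> Y) : f ∈ L -> exists q : Y ~> X, q ∘ f = idm X.
Proof.
intros hf.
destruct (wfs_lifts HLR hf (R_bang X) (u := idm X) (v := bang Y)) as [q [q1 _]].
{ apply bang_unique. }
now exists q.
Qed.

Definition path_object (X : C) (P : obj_relation X) : Prop :=
  is_identity_type R (obj_relation_to_one P).

Section PathObject.
Context (X : C) (P : obj_relation X) (HP : path_object P).

(** A lift of [l] against the endpoint map of [P] into the product. Every path constructed from
    identity types below is obtained this way. *)
Lemma path_object_lifts (A B : C) (l : A ~> B) (u : A ~> Psi P) (x y : B ~> X) :
  l ∈ L -> eps0 P ∘ u = x ∘ l -> eps1 P ∘ u = y ∘ l ->
  exists h : B ~> Psi P, h ∘ l = u /\ eps0 P ∘ h = x /\ eps1 P ∘ h = y.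
Proof.
intros hl ex ey.
destruct (wfs_lifts HLR hl (proj1 HP)
  (u := u) (v := pbpair x y (bang_unique _ _))) as [h [h1 h2]].
{ apply pb_ext; simpl; now cat. }
apply (f_equal (comp (pr0 _ _))) in h2 as h3.
apply (f_equal (comp (pr1 _ _))) in h2 as h4.
revert h3 h4; simpl; cat; now exists h.
Qed.

Lemma path_object_unit (A : C) (f : A ~> X) (i : bool)
    (e : f ∘ idm A = eps P i ∘ (eta P ∘ f)) :
  pbpair (idm A) (eta P ∘ f) e ∈ L.
Proof.
apply (L_of_lifts HLR).
rewrite (pbpair_irrelevance _ (Id_eta_comm (obj_relation_to_one P) f i)).
exact (proj2 HP A f i).
Qed.

Lemma path_object_eps (i : bool) : eps P i ∈ R.
Proof.
destruct i.
- change (mor (eps1 (obj_relation_to_one P)) ∈ R).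
  rewrite <- (pr1_pbpair (Id_eps_comm (obj_relation_to_one P))).
  apply (R_comp HLR); [apply (R_pr1 HLR), R_bang | apply HP].
- change (mor (eps0 (obj_relation_to_one P)) ∈ R).
  rewrite <- (pr0_pbpair (Id_eps_comm (obj_relation_to_one P))).
  apply (R_comp HLR); [apply (R_pr0 HLR), R_bang | apply HP].
Qed.

(** The map factors as the pullback of [(eps0, eps1)] along [f] times the identity, followed by the
    projection from the product of [Z] and [X] to [X]. *)
Lemma path_object_rho (Z : C) (f : Z ~> X) : eps1 P ∘ pr1 f (eps0 P) ∈ R.
Proof.
set (k := pbpair (pr0 f (eps0 P)) (eps1 P ∘ pr1 f (eps0 P)) (bang_unique _ _)
  : _ ~> pb (bang Z) (bang X)).
assert (hk : pr1 (bang Z) (bang X) ∘ k = eps1 P ∘ pr1 f (eps0 P)) by apply pr1_pbpair.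
rewrite <- hk; apply (R_comp HLR); [apply (R_pr1 HLR), R_bang |].
apply (R_pullback HLR) with (2 := proj1 HP) (p := pr1 f (eps0 P))
  (b := pbpair (f ∘ pr0 (bang Z) (bang X)) (pr1 _ _) (bang_unique _ _)).
split.
- unfold k; apply pb_ext; simpl; cat; trivial; symmetry; apply pb_square.
- intros T x y exy.
  apply (f_equal (comp (pr0 _ _))) in exy as e0.
  apply (f_equal (comp (pr1 _ _))) in exy as e1.
  revert e0 e1; simpl; cat; intros e0 e1.
  exists (pbpair (pr0 _ _ ∘ y) x (eq_sym e0)); repeat split.
  + now cat.
  + unfold k; apply pb_ext; now cat.
  + intros h [h0 h1]; apply pb_ext; cat; [| now symmetry].
    rewrite <- h1; unfold k; now cat.
Qed.

End PathObject.

Lemma FF_of_path_objects (I : cat_relation C) :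
  (forall X, path_object (I X)) ->
  is_weak_factorization_structure (FF I) /\ generates (FF I) L R.
Proof.
intros HI; apply (generates_of_factorization HLR); intros X Y f; simpl.
- apply path_object_unit, HI.
- apply path_object_rho, HI.
Qed.

(** Two lifts of the unit [(1, eta p)], which is in [L]: against [p] for the transport, then against
    the endpoint map of [P E] for the path. *)
Lemma path_transport_of_path_objects (P : forall X : C, obj_relation X) :
  (forall X, path_object (P X)) ->
  forall (E B : C) (p : E ~> B), p ∈ R -> path_transport P p.
Proof.
intros HP E B p hp.
assert (e : p ∘ idm E = eps1 (P B) ∘ (eta (P B) ∘ p)) by now cat.
assert (hu := path_object_unit (HP B) e).
destruct (wfs_lifts HLR hu hp (u := idm E) (v := eps0 (P B) ∘ pr1 _ _))
  as [t [t1 t2]]; [now cat |].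
destruct (path_object_lifts (HP E) hu (u := eta (P E)) (x := t) (y := pr0 _ _))
  as [k [k1 [k2 k3]]]; [now rewrite t1; cat | now cat |].
exists t, k; repeat split; trivial.
intros T x e'.
rewrite <- k1, <- comp_assoc; f_equal; apply pb_ext; now cat.
Qed.

Lemma type_theoretic_of_path_objects (I : cat_relation C) :
  (forall X, path_object (I X)) -> type_theoretic L R.
Proof.
intros HI; split; [exact fib |].
apply (L_stable_of_path_transport (P := I)).
- intros A B l; rewrite <- coalg_FF; symmetry; now apply FF_of_path_objects.
- now apply path_transport_of_path_objects.
Qed.

End IdentityTypes.

(** * Passing from relations on the slice over the terminal object to relations on the category *)

Section RelationOfSlice.
Context (C : lex_category).

Definition obj_relation_of_slice (X : C)
    (r : @obj_relation (slice C one) (SliceObj (bang X))) : obj_relation X :=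
  @ObjRelation _ X (dom (Psi r)) (mor (eta r)) (fun i => mor (eps r i))
    (fun i => f_equal mor (eps_eta r i)).

Definition relation_of_slice (J : cat_relation (slice C one)) : cat_relation C :=
  @CatRelation C (fun X => obj_relation_of_slice (J (SliceObj (bang X))))
    (fun X Y f => mor (Psi_map J (to_one f)))
    (fun X Y f i => f_equal mor (Psi_map_eps J (to_one f) i))
    (fun X Y f => f_equal mor (Psi_map_eta J (to_one f))).

Lemma path_object_of_slice (R : mor_class C) (X : C)
    (r : @obj_relation (slice C one) (SliceObj (bang X))) :
  is_identity_type R r -> path_object R (obj_relation_of_slice r).
Proof.
intros [h1 h2]; split.
- rewrite (pbpair_irrelevance _ (Id_eps_comm r)); exact h1.
- intros A f i; rewrite (pbpair_irrelevance _ (Id_eta_comm r f i)); apply h2.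
Qed.

End RelationOfSlice.

(** Since [Psi_map] need not be functorial, its values can be chosen separately for each
    morphism. *)
Lemma cat_relation_exists (D : category) (P : forall X : D, obj_relation X -> Prop) :
  (forall X : D, exists r : obj_relation X, P X r) ->
  (forall (X Y : D) (r : obj_relation X) (s : obj_relation Y) (f : X ~> Y),
    P X r -> P Y s -> exists k : Psi r ~> Psi s,
      (forall i, eps s i ∘ k = f ∘ eps r i) /\ k ∘ eta r = eta s ∘ f) ->
  exists I : cat_relation D, forall X, P X (I X).
Proof.
intros hP hmap.
destruct (dependent_functional_choice hP) as [r hr].
destruct (dependent_functional_choice
  (* Morphisms are packed with their endpoints so that a single choice covers all of them. *)
  (fun t : {X : D & {Y : D & X ~> Y}} =>
    hmap _ _ _ _ (projT2 (projT2 t)) (hr (projT1 t)) (hr (projT1 (projT2 t)))))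
  as [k hk].
exists (@CatRelation D r (fun X Y f => k (existT _ X (existT _ Y f)))
  (fun X Y f => proj1 (hk (existT _ X (existT _ Y f))))
  (fun X Y f => proj2 (hk (existT _ X (existT _ Y f))))).
exact hr.
Qed.

(** * Identity types from a type-theoretic system *)

Section TypeTheoretic.
Context (C : lex_category) (L R : mor_class C) (HLR : is_wfs L R).
Context (HT : type_theoretic L R).

(* Factor [f] as [l] in L followed by [q] in R.  Over the codomain of [q] the
   section is a pullback of [s] along an R-map; the comparison of the two
   pullbacks is a pullback of [l] along an R-map, hence in L and a split mono. *)
Lemma section_pullback (Q Y A : C) (p : Q ~> Y) (s : Y ~> Q) (f : A ~> Y)
    (e : f ∘ idm A = p ∘ (s ∘ f)) :
  p ∈ R -> s ∈ L -> p ∘ s = idm Y -> pbpair (idm A) (s ∘ f) e ∈ L.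
Proof.
intros hp hs ps.
destruct (wfs_factor HLR f) as [Z [l [q [hl [hq ql]]]]].
assert (eZ : q ∘ idm Z = p ∘ (s ∘ q)) by now rewrite (whisker ps); cat.
assert (hZ : pbpair (idm Z) (s ∘ q) eZ ∈ L).
{ apply (proj2 HT) with (2 := hs) (p := q) (b := pr1 q p); [| now apply (R_pr1 HLR)].
  split; [now cat |].
  intros T x y exy.
  assert (qy : q ∘ (pr0 q p ∘ y) = x).
  { now rewrite (whisker (pb_square q p)), <- comp_assoc, <- exy, (whisker ps), comp_idl. }
  exists (pr0 q p ∘ y); repeat split; [exact qy | |].
  - apply pb_ext; cat; trivial; now rewrite <- exy, <- qy.
  - intros h [_ <-]; now cat. }
assert (e' : q ∘ (l ∘ pr0 f p) = p ∘ pr1 f p) by now rewrite (whisker ql), pb_square.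
assert (hl' : pbpair _ _ e' ∈ L).
{ apply (proj2 HT) with (2 := hl) (p := pr0 f p) (b := pr0 q p);
    [| now apply (R_pr0 HLR)].
  split; [now cat |].
  intros T x y exy.
  assert (exy' : f ∘ x = p ∘ (pr1 q p ∘ y)).
  { now rewrite <- ql, <- comp_assoc, exy, !comp_assoc, pb_square. }
  exists (pbpair _ _ exy'); repeat split; [now cat | |].
  - apply pb_ext; now cat.
  - intros h [<- <-]; apply pb_ext; now cat. }
destruct (L_split_mono HLR (proj1 HT) hl') as [g hg].
apply (L_cancel HLR) with (1 := hg).
replace (pbpair _ _ e' ∘ pbpair (idm A) (s ∘ f) e)
  with (pbpair (idm Z) (s ∘ q) eZ ∘ l); [now apply (L_comp HLR) |].
apply pb_ext; cat; trivial; now rewrite ql.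
Qed.

Section Slice.
Context (Y : C).

(** Formulated for every object of the slice, because [models_Id] asks for a relation on the whole
    slice; over maps in [R] it yields identity types. *)
Definition factors_diagonal (f : slice C Y) (r : obj_relation f) : Prop :=
  mor (eta r) ∈ L /\
  forall e, pbpair (a := arr f) (b := arr f) (mor (eps0 r)) (mor (eps1 r)) e ∈ R.

Lemma factors_diagonal_exists (f : slice C Y) : exists r, @factors_diagonal f r.
Proof.
destruct (wfs_factor HLR (pbpair (idm (dom f)) (idm (dom f)) (eq_refl (arr f ∘ idm _))))
  as [Z [l [k [hl [hk kl]]]]].
assert (k0 : pr0 _ _ ∘ k ∘ l = idm (dom f)) by now rewrite <- comp_assoc, kl; cat.
assert (k1 : pr1 _ _ ∘ k ∘ l = idm (dom f)) by now rewrite <- comp_assoc, kl; cat.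
(* The middle object lies over [Y] through either projection; the first is taken as its structure
   map. *)
pose (z := SliceObj (arr f ∘ (pr0 _ _ ∘ k))).
assert (hz0 : arr f ∘ (pr0 _ _ ∘ k) = arr z) by reflexivity.
assert (hz1 : arr f ∘ (pr1 _ _ ∘ k) = arr z) by now simpl; rewrite !comp_assoc, pb_square.
assert (hl' : arr z ∘ l = arr f) by now simpl; rewrite <- comp_assoc, k0, comp_idr.
unshelve eexists (@ObjRelation (slice C Y) f z (@SliceHom _ _ f z l hl')
  (fun i => if i then @SliceHom _ _ z f _ hz1 else @SliceHom _ _ z f _ hz0) _).
{ intros [|]; apply slice_hom_eq; assumption. }
split; [exact hl |]; intros e.
replace (pbpair _ _ e) with k; [exact hk | apply pb_ext; now cat].
Qed.

(** The action on [u] is a lift of [eta r] against the endpoint map of [s]. *)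
Lemma factors_diagonal_map (f g : slice C Y) (r : obj_relation f)
    (s : obj_relation g) (u : f ~> g) :
  factors_diagonal r -> factors_diagonal s ->
  exists k : Psi r ~> Psi s,
    (forall i, eps s i ∘ k = u ∘ eps r i) /\ k ∘ eta r = eta s ∘ u.
Proof.
intros [hr _] [_ hs].
assert (e : arr g ∘ mor (eps0 s) = arr g ∘ mor (eps1 s)) by now rewrite !mor_comm.
assert (e' : arr g ∘ (mor u ∘ mor (eps0 r)) = arr g ∘ (mor u ∘ mor (eps1 r))).
{ now rewrite !comp_assoc, !mor_comm. }
assert (es : forall i, mor (eps s i) ∘ mor (eta s) = idm _)
  by (intros i; exact (f_equal mor (eps_eta s i))).
assert (er : forall i, mor (eps r i) ∘ mor (eta r) = idm _)
  by (intros i; exact (f_equal mor (eps_eta r i))).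
destruct (wfs_lifts HLR hr (hs e) (u := mor (eta s) ∘ mor u) (v := pbpair _ _ e'))
  as [h [h1 h2]].
{ apply pb_ext; cat; now rewrite (whisker (es _)), er, comp_idl, comp_idr. }
apply (f_equal (comp (pr0 _ _))) in h2 as h3.
apply (f_equal (comp (pr1 _ _))) in h2 as h4.
revert h3 h4; cat; intros h3 h4.
assert (hh : arr (Psi s) ∘ h = arr (Psi r)).
{ now rewrite <- (mor_comm (eps0 s)), <- comp_assoc, h3, comp_assoc, !mor_comm. }
exists (@SliceHom _ _ (Psi r) (Psi s) h hh); split.
- intros [|]; now apply slice_hom_eq.
- now apply slice_hom_eq.
Qed.

(** Each endpoint map is the diagonal's [R]-factor followed by a pullback of [f], so it is in [R],
    and [section_pullback] applies to its section [eta r]. *)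
Lemma identity_type_of_factors_diagonal (X : C) (f : X ~> Y)
    (r : @obj_relation (slice C Y) (SliceObj f)) :
  f ∈ R -> factors_diagonal r -> is_identity_type R r.
Proof.
intros hf [hl hk]; split; [apply hk |].
intros A x i; apply (LLP_of_L HLR); apply section_pullback; [| exact hl |].
- specialize (hk (Id_eps_comm r)); destruct i.
  + rewrite <- (pr1_pbpair (Id_eps_comm r)).
    apply (R_comp HLR); [now apply (R_pr1 HLR) | exact hk].
  + rewrite <- (pr0_pbpair (Id_eps_comm r)).
    apply (R_comp HLR); [now apply (R_pr0 HLR) | exact hk].
- exact (f_equal mor (eps_eta r i)).
Qed.

End Slice.

Lemma type_theoretic_models_Id : models_Id R.
Proof.
intros Y.
destruct (cat_relation_exists (factors_diagonal_exists (Y := Y))) as [I hI].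
{ apply factors_diagonal_map. }
exists I; intros X f hf; apply identity_type_of_factors_diagonal; auto.
Qed.

Lemma type_theoretic_display : display_map_category R.
Proof.
repeat split.
- apply (R_iso HLR).
- intros X T f; apply (proj1 HT).
- apply (R_pullback HLR).
Qed.

(** * Moore structure on path objects *)

Section Moore.
Context (I : cat_relation C) (HI : forall X, path_object R (I X)).
Let fib := proj1 HT.

Lemma path_objects_transitive : transitive_relation I.
Proof.
intros X.
destruct (path_object_lifts HLR (HI X) (path_object_unit HLR (HI X) (mu_unit_comm I X))
  (u := idm _) (x := eps0 (I X) ∘ pr0 _ _) (y := eps1 (I X) ∘ pr1 _ _))
  as [m [m1 [m2 m3]]]; [now cat | now cat | now exists m].
Qed.

(** [path_object_unit] has the constant path as second component while [nu] expects it first, so the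
    lift is precomposed with the swap. *)
Lemma path_objects_symmetric : symmetric_relation I.
Proof.
intros X.
assert (e : eps0 (I X) ∘ idm _ = eps0 (I X) ∘ (eta (I X) ∘ eps0 (I X))) by now cat.
destruct (path_object_lifts HLR (HI X) (path_object_unit HLR (HI X) e)
  (u := idm _) (x := eps1 (I X) ∘ pr1 _ _) (y := eps1 (I X) ∘ pr0 _ _))
  as [m [m1 [m2 m3]]]; [now cat | now cat |].
exists (m ∘ pbpair _ _ (eq_sym (pb_square (eps0 (I X)) (eps0 (I X))))); repeat split.
- rewrite (whisker m2); now cat.
- rewrite (whisker m3); now cat.
- rewrite <- m1, <- comp_assoc; f_equal; apply pb_ext; now cat.
Qed.

(** This is the unit map for [idm X], with the pullback along the identity replaced by the path
    object. *)
Lemma eta_L (X : C) : eta (I X) ∈ L.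
Proof.
assert (e : idm X ∘ idm X = eps0 (I X) ∘ (eta (I X) ∘ idm X)) by now cat.
assert (e' : idm X ∘ eps0 (I X) = eps0 (I X) ∘ idm _) by now cat.
apply (L_cancel HLR) with (g := pbpair _ _ e') (q := pr1 _ _); [now cat |].
replace (pbpair _ _ e' ∘ eta (I X)) with (pbpair _ _ e);
  [apply (path_object_unit HLR (HI X)) | apply pb_ext; now cat].
Qed.

(* [PsiS] is obtained from the object of triples [(z, a, b)] of paths with
   [a] and [b] starting at the two ends of [z]. *)
Lemma square_structure_exists (X : C) :
  exists S : square_structure I X, etaS S ∈ L /\ zetaS S ∈ R.
Proof.
set (W := pb (eps0 (I X)) (eps0 (I X))).
set (z := pr0 (eps0 (I X)) (eps0 (I X))).
set (a := pr1 (eps0 (I X)) (eps0 (I X))).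
set (c := pr0 (eps1 (I X) ∘ z) (eps0 (I X))).
set (b := pr1 (eps1 (I X) ∘ z) (eps0 (I X))).
assert (hz : z ∈ R) by apply (R_pr0 HLR), (path_object_eps HLR fib (HI X)).
assert (hc : c ∈ R) by apply (R_pr0 HLR), (path_object_eps HLR fib (HI X)).
assert (e1 : eps0 (I X) ∘ eta (I X) = eps0 (I X) ∘ eta (I X)) by reflexivity.
assert (e2 : (eps1 (I X) ∘ z) ∘ pbpair _ _ e1 = eps0 (I X) ∘ eta (I X))
  by now unfold z; cat.
(* Factoring the constant triple puts [etaS] in [L], and composing with [k] keeps [zetaS] in [R]. *)
destruct (wfs_factor HLR (pbpair _ _ e2)) as [S [l [k [hl [hk kl]]]]].
assert (kz : z ∘ c ∘ k ∘ l = eta (I X))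
  by now rewrite <- !comp_assoc, kl; unfold z, c; cat.
assert (ka : a ∘ c ∘ k ∘ l = eta (I X))
  by now rewrite <- !comp_assoc, kl; unfold a, c; cat.
assert (kb : b ∘ k ∘ l = eta (I X))
  by now rewrite <- !comp_assoc, kl; unfold b; cat.
(* [deltaS] must lie over the triple whose [z] and [a] are constant at the source of a path and
   whose [b] is the path itself. *)
assert (e3 : eps0 (I X) ∘ (eta (I X) ∘ eps0 (I X)) = eps0 (I X) ∘ (eta (I X) ∘ eps0 (I X)))
  by reflexivity.
assert (e4 : (eps1 (I X) ∘ z) ∘ pbpair _ _ e3 = eps0 (I X) ∘ idm _)
  by now unfold z; cat.
destruct (wfs_lifts HLR (eta_L X) hk (u := l) (v := pbpair _ _ e4)) as [d [d1 d2]].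
{ rewrite kl; apply pb_ext; cat; trivial; apply pb_ext; now cat. }
unshelve eexists (@SquareStructure _ I X S l
  (fun i => if i then b ∘ k else a ∘ c ∘ k) (z ∘ c ∘ k) d _ _ _ _ _ _ _).
- intros [|]; assumption.
- exact kz.
- intros [|].
  + unfold b; rewrite comp_assoc, <- pb_square; now cat.
  + unfold a; rewrite !comp_assoc, <- pb_square; now cat.
- exact d1.
- rewrite <- !comp_assoc, d2; unfold a, c; now cat.
- rewrite <- !comp_assoc, d2; unfold z, c; now cat.
- rewrite <- !comp_assoc, d2; unfold b; now cat.
- split; [exact hl |]; now repeat apply (R_comp HLR).
Qed.

(** The case of the identity on [Y] is pulled back along [f] by [section_pullback]; pasting
    identifies the two pullbacks involved. *)
Lemma tau_unit_L (X Y : C) (S : square_structure I Y) (f : X ~> Y) :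
  etaS S ∈ L -> zetaS S ∈ R ->
  pbpair (idm X) (etaS S ∘ f) (tau_unit_comm S f) ∈ L.
Proof.
intros hl hr.
set (p := pr0 (eta (I Y)) (zetaS S)).
assert (e : eta (I Y) ∘ idm Y = zetaS S ∘ etaS S) by now rewrite zetaS_eta; cat.
assert (hp : p ∈ R) by now apply (R_pr0 HLR).
assert (hs : pbpair _ _ e ∈ L).
(* The second projection is a pullback of [eta] along [zetaS], so it is in [L] and split mono; it
   carries the pair to [etaS], which is in [L]. *)
{ destruct (L_split_mono HLR fib (proj2 HT _ _ _ _ _ _ _ _
    (pb_is_pullback (eta (I Y)) (zetaS S)) (eta_L Y) hr)) as [q hq].
  apply (L_cancel HLR) with (1 := hq); now cat. }
assert (e1 : f ∘ idm X = p ∘ (pbpair _ _ e ∘ f)) by now unfold p; cat.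
assert (h := section_pullback e1 hp hs (pr0_pbpair e)).
assert (e2 : eta (I Y) ∘ (f ∘ pr0 _ _) = zetaS S ∘ pr1 (eta (I Y) ∘ f) (zetaS S)).
{ now rewrite comp_assoc, pb_square. }
assert (e3 : f ∘ pr0 (eta (I Y) ∘ f) (zetaS S) = p ∘ pbpair _ _ e2) by now unfold p; cat.
assert (e4 : (eta (I Y) ∘ f) ∘ pr0 f p = zetaS S ∘ (pr1 _ _ ∘ pr1 f p)).
{ rewrite <- comp_assoc, pb_square; unfold p; now rewrite !comp_assoc, pb_square. }
apply (L_cancel HLR) with (g := pbpair _ _ e3) (q := pbpair _ _ e4).
- apply pb_ext; now cat.
- replace (pbpair _ _ e3 ∘ _) with (pbpair _ _ e1); [exact h |].
  apply pb_ext; cat; trivial; apply pb_ext; now cat.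
Qed.

(** [tau] extends the constant path along the unit of [tau_unit_L], with the prescribed
    endpoints. *)
Lemma path_objects_homotopical : homotopical_relation I.
Proof.
destruct (dependent_functional_choice square_structure_exists) as [S hS].
exists S; intros X Y f.
destruct (path_object_lifts HLR (HI _) (tau_unit_L f (proj1 (hS Y)) (proj2 (hS Y)))
  (u := eta (I _) ∘ pbpair _ _ (Flam_comm I f))
  (x := pbpair _ _ (tau_eps_comm (S Y) f false))
  (y := pbpair _ _ (tau_eps_comm (S Y) f true))) as [t [t1 [t2 t3]]].
- apply pb_ext; cat; trivial; now rewrite (whisker (epsS_eta (S Y) _)).
- apply pb_ext; cat; trivial; now rewrite (whisker (epsS_eta (S Y) _)).
- exists t; split; [exact t1 | now intros [|]].
Qed.

Lemma path_objects_Moore : Moore_relation_system I.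
Proof.
split; [apply path_objects_transitive |].
split; [apply path_objects_homotopical | apply path_objects_symmetric].
Qed.

End Moore.
End TypeTheoretic.

(** * Assembling the equivalences *)

Lemma path_objects_of_models_Id (C : lex_category) (D : mor_class C) :
  (forall X, bang X ∈ D) -> models_Id D ->
  exists I : cat_relation C, forall X, path_object D (I X).
Proof.
intros hb hI; destruct (hI one) as [J hJ].
exists (relation_of_slice J); intros X; now apply path_object_of_slice, hJ.
Qed.

(** The class occurs positively in the endpoint condition and negatively in [LLP], so both
    inclusions are used. *)
Lemma is_identity_type_mono (C : lex_category) (D E : mor_class C) (X Y : C)
    (f : X ~> Y) (r : @obj_relation (slice C Y) (SliceObj f)) :
  same_class D E -> is_identity_type D r -> is_identity_type E r.
Proof.
intros h [h1 h2]; split; [now apply h |].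
intros A x i S T q hq; apply h2; now apply h.
Qed.

Lemma fibrant_of_generates (C : lex_category) (I : cat_relation C) (L R : mor_class C) :
  generates (FF I) L R -> forall X, fibrant R X.
Proof. intros [_ gR] X T f hT; apply gR; now apply fibrant_FF. Qed.

Lemma type_theoretic_of_Moore (C : lex_category) (M : cat_relation C) (L R : mor_class C) :
  homotopical_relation M -> symmetric_relation M -> generates (FF M) L R ->
  type_theoretic L R.
Proof.
intros hom sym g; split; [exact (fibrant_of_generates g) |]; destruct g as [gL gR].
apply (L_stable_of_path_transport (P := M)).
- intros A B l; rewrite <- coalg_FF; symmetry; apply gL.
- intros E B p hp; apply alg_path_transport; trivial; now apply gR.
Qed.

Theorem theorem7p2 (C : lex_category) (L R : mor_class C) (HLR : is_wfs L R) :
  let has_Id_presentation :=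
    exists I : cat_relation C, Id_presentation I /\ generates (FF I) L R in
  let generated_by_Moore :=
    exists M : cat_relation C,
      Moore_relation_system M /\
      is_weak_factorization_structure (FF M) /\
      generates (FF M) L R in
  let models_Sigma_and_Id :=
    display_map_category R /\ models_Sigma R /\ models_Id R in
  (has_Id_presentation <-> type_theoretic L R) /\
  (type_theoretic L R <-> generated_by_Moore) /\
  (generated_by_Moore <-> models_Sigma_and_Id).
Proof.
intros P1 P3 P4.
(* Each other condition is compared with type-theoreticity; these path objects serve both [P1] and
   [P3]. *)
assert (path_objects : type_theoretic L R ->
  exists I : cat_relation C, forall X, path_object R (I X)).
{ intros HT; apply path_objects_of_models_Id; [apply R_bang, HT |].
  now apply (type_theoretic_models_Id HLR). }
assert (h12 : P1 -> type_theoretic L R).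
{ intros [I [[_ hI] g]].
  apply (type_theoretic_of_path_objects HLR (fibrant_of_generates g) (I := I)).
  intros X; exact (is_identity_type_mono (proj2 g) (hI X)). }
assert (h21 : type_theoretic L R -> P1).
{ intros HT; destruct (path_objects HT) as [I hI].
  destruct (FF_of_path_objects HLR (proj1 HT) hI) as [w g].
  exists I; split; [split; [exact w |] | exact g].
  (* An [Id]-presentation refers to the algebras of its own factorization, which form the class
     [R]. *)
  intros X; refine (is_identity_type_mono _ (hI X)).
  intros A B f; symmetry; apply (proj2 g). }
assert (h23 : type_theoretic L R -> P3).
{ intros HT; destruct (path_objects HT) as [I hI].
  exists I; split; [now apply (path_objects_Moore HLR HT) |].
  now apply (FF_of_path_objects HLR (proj1 HT)). }
assert (h32 : P3 -> type_theoretic L R).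
{ intros [M [[_ [hom sym]] [_ g]]]; exact (type_theoretic_of_Moore hom sym g). }
assert (h24 : type_theoretic L R -> P4).
{ intros HT; split; [now apply (type_theoretic_display HLR) |].
  split; [apply (R_comp HLR) | now apply (type_theoretic_models_Id HLR)]. }
assert (h42 : P4 -> type_theoretic L R).
{ intros [[_ [hD _]] [_ hI]].
  assert (fib : forall X, fibrant R X) by exact (fun X T f => hD X T f).
  destruct (path_objects_of_models_Id (R_bang fib) hI) as [I HI].
  exact (type_theoretic_of_path_objects HLR fib HI). }
tauto.
Qed.
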